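(* Let $a,b,c\in\mathbb{R}$ with $c\neq 0$ and $(a,b)\neq(0,0)$, and let $p\geq 1$ be an integer. Consider the system for $u=u(t,x)$, $v=v(t,x)$ $$F_1\equiv u_t + a[(u^p + v^p)u]_x + b[(uv)^pv]_x + cu_{xxx} = 0,\qquad F_2\equiv v_t + a[(u^p + v^p)v]_x + b[(uv)^pu]_x + cv_{xxx} = 0,$$ and the vector fields $$X_1 = 3t\frac{\partial}{\partial t} + x\frac{\partial}{\partial x} - \frac{1}{p}\left(u\frac{\partial}{\partial u} + v\frac{\partial}{\partial v}\right),\quad Y_1 = 3t\frac{\partial}{\partial t} + x\frac{\partial}{\partial x} - \frac{2}{p}\left(u\frac{\partial}{\partial u} + v\frac{\partial}{\partial v}\right),\quad X_2=\frac{\partial}{\partial t}.$$ Conserved vectors are constructed from a vector field and a pair $(\varphi,\psi)$ by Ibragimov's formulas, and ''provides'' is understood as defined in the context. i) Let $a=0$. For $\varphi=u$, $\psi=v$, the field $X_1$ provides the conserved vector $$C^t = (p + 1)(u^2 + v^2),\qquad C^x = 2b(2p + 1)(uv)^{p + 1} + c(p + 1)\left[(u^2 + v^2)_{xx} - 3(u_x^2 + v_x^2)\right].$$ ii) Let $b=0$. ii.a) If $p=1$, then $Y_1$ with $\varphi=\psi=u+v$, and likewise $X_2$ with $\varphi=\psi=2at(u+v)-x$, provides the conserved vector $$C^t = 3(u + v)^2,\qquad C^x = 4a(u + v)^3 + 3c\left\{[(u + v)^2]_{xx} - 3(u_x + v_x)^2\right\}.$$ ii.b) If $p=2$, then $Y_1$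 with $\varphi=u$, $\psi=v$ also provides the conserved vector $$C^t = 2(u^2 + v^2),\qquad C^x = 3a(u^2 + v^2)^2 + 2c\left[(u^2 + v^2)_{xx} - 3(u_x^2 + v_x^2)\right].$$
   Context: All functions are smooth; $D_t,D_x$ denote total derivatives. A pair $(C^t,C^x)$ of functions of $t,x,u,v$ and derivatives of $u,v$ is a conserved vector of the system if $D_tC^t+D_xC^x=0$ on all solutions of the system. A conserved vector is trivial if on solutions of the system it has the form $(D_x\theta,-D_t\theta)$ for some function $\theta$ of $t,x,u,v$ and derivatives of $u,v$. Put $f(u,v)=a(u^p+v^p)u+b(uv)^pv$ and $g(u,v)=a(u^p+v^p)v+b(uv)^pu$. For a vector field $X=\mathcal{T}\partial_t+\mathcal{X}\partial_x+\mathcal{U}\partial_u+\mathcal{V}\partial_v$, put $W^u=\mathcal{U}-\mathcal{T}u_t-\mathcal{X}u_x$ and $W^v=\mathcal{V}-\mathcal{T}v_t-\mathcal{X}v_x$. For functions $\varphi(t,x,u,v),\psi(t,x,u,v)$, Ibragimov's formulas define $C_{X,\varphi,\psi}=(C^t_{X,\varphi,\psi},C^x_{X,\varphi,\psi})$ by $$C^t_{X,\varphi,\psi}=\varphi W^u+\psi W^v,$$ $$C^x_{X,\varphi,\psi}=\varphi(f_uW^u+f_vW^v)+c\left(\varphi D_x^2W^u-(D_x\varphi)D_xW^u+(D_x^2\varphi)W^u\right)+\psi(g_uW^u+g_vW^v)+c\left(\psi D_x^2W^v-(D_x\psi)D_xW^v+(D_x^2\psi)W^v\right).$$ The field $X$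 with the pair $(\varphi,\psi)$ ''provides'' the conserved vector $(C^t,C^x)$ if $C_{X,\varphi,\psi}$ is equal, on solutions of the system and up to a trivial conserved vector, to a nonzero real constant multiple of $(C^t,C^x)$.
   Formalization: Part i) is stated for p ≠ 2 only: at p = 2 the vector constructed from X_1 with φ = u, ψ = v is itself trivial (the constant (p−2)/(2p(p+1)) vanishes) while (C^t, C^x) is not trivial, so the claim fails there. *)

(* Defs.v *)
From Stdlib Require Import Reals List.
From Coquelicot Require Import Coquelicot.
Open Scope R_scope.

(* Coordinates of the infinite jet space of maps (t,x) |-> (u,v):
   [cu i j] stands for the derivative of u taken i times in t and j times in x,
   so [cu 0 0] is u itself. *)
Inductive coord : Set :=
| ct | cx | cu (i j : nat) | cv (i j : nat).

Definition coord_eq_dec (k l : coord) : {k = l} + {k <> l}.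
Proof. decide equality; apply PeanoNat.Nat.eq_dec. Defined.

Definition jet : Type := coord -> R.

Definition t_ (z : jet) : R := z ct.
Definition x_ (z : jet) : R := z cx.
Definition u_ (z : jet) : R := z (cu 0 0).
Definition u_t (z : jet) : R := z (cu 1 0).
Definition u_x (z : jet) : R := z (cu 0 1).
Definition u_xxx (z : jet) : R := z (cu 0 3).
Definition v_ (z : jet) : R := z (cv 0 0).
Definition v_t (z : jet) : R := z (cv 1 0).
Definition v_x (z : jet) : R := z (cv 0 1).
Definition v_xxx (z : jet) : R := z (cv 0 3).

Definition upd (z : jet) (k : coord) (s : R) : jet :=
  fun l => if coord_eq_dec l k then s else z l.

Definition pd (k : coord) (F : jet -> R) : jet -> R :=
  fun z => Derive (fun s => F (upd z k s)) (z k).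

Fixpoint pds (l : list coord) (F : jet -> R) : jet -> R :=
  match l with
  | nil => F
  | cons k l' => pd k (pds l' F)
  end.

Definition order_le (n : nat) (k : coord) : Prop :=
  match k with
  | ct | cx => True
  | cu i j | cv i j => (i + j <= n)%nat
  end.

Definition finite_order (F : jet -> R) : Prop :=
  exists n : nat, forall z z' : jet,
    (forall k, order_le n k -> z k = z' k) -> F z = F z'.

(* [continuous] refers to the topology of uniform convergence on [coord -> R];
   for a function of finite order this is ordinary joint continuity in the
   finitely many coordinates on which it depends. *)
Definition smooth (F : jet -> R) : Prop :=
  forall (l : list coord) (z : jet),
    continuous (pds l F) z /\
    (forall k, ex_derive (fun s => pds l F (upd z k s)) (z k)).

(* Functions of t, x, u, v and (finitely many) derivatives of u, v. *)
Definition diff_function (F : jet -> R) : Prop := finite_order F /\ smooth F.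

(* The total derivatives are the vector fields
     d/dt + sum (u_{i+1,j} d/du_{i,j} + v_{i+1,j} d/dv_{i,j}),
     d/dx + sum (u_{i,j+1} d/du_{i,j} + v_{i,j+1} d/dv_{i,j})
   on jet space. [vec_t z] and [vec_x z] are their components at z, and the
   fields act on F by differentiation in that direction, which by the chain
   rule is the above sum when F is smooth of finite order. *)
Definition vec_t (z : jet) : jet := fun k =>
  match k with
  | ct => 1
  | cx => 0
  | cu i j => z (cu (S i) j)
  | cv i j => z (cv (S i) j)
  end.

Definition vec_x (z : jet) : jet := fun k =>
  match k with
  | ct => 0
  | cx => 1
  | cu i j => z (cu i (S j))
  | cv i j => z (cv i (S j))
  end.

Definition Dtot_t (F : jet -> R) : jet -> R :=
  fun z => Derive (fun s => F (fun k => z k + s * vec_t z k)) 0.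

Definition Dtot_x (F : jet -> R) : jet -> R :=
  fun z => Derive (fun s => F (fun k => z k + s * vec_x z k)) 0.

Definition F1 (a b c : R) (p : nat) (z : jet) : R :=
  u_t z + a * Dtot_x (fun z => (u_ z ^ p + v_ z ^ p) * u_ z) z
  + b * Dtot_x (fun z => (u_ z * v_ z) ^ p * v_ z) z + c * u_xxx z.

Definition F2 (a b c : R) (p : nat) (z : jet) : R :=
  v_t z + a * Dtot_x (fun z => (u_ z ^ p + v_ z ^ p) * v_ z) z
  + b * Dtot_x (fun z => (u_ z * v_ z) ^ p * u_ z) z + c * v_xxx z.

(* The first argument of u and v is t, the second is x. *)
Definition jet_at (u v : R -> R -> R) (t x : R) : jet := fun k =>
  match k with
  | ct => t
  | cx => x
  | cu i j => partial_derive i j u t x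
  | cv i j => partial_derive i j v t x
  end.

Definition solution (a b c : R) (p : nat) (O : R * R -> Prop)
    (u v : R -> R -> R) : Prop :=
  open O /\
  forall t x, O (t, x) ->
    (forall n, ex_diff_n u n t x) /\ (forall n, ex_diff_n v n t x) /\
    F1 a b c p (jet_at u v t x) = 0 /\ F2 a b c p (jet_at u v t x) = 0.

(* Solutions may be defined on an arbitrary open subset of the (t,x)-plane. *)
Definition eq_on_solutions (a b c : R) (p : nat) (F G : jet -> R) : Prop :=
  forall O u v, solution a b c p O u v ->
  forall t x, O (t, x) -> F (jet_at u v t x) = G (jet_at u v t x).

Definition conserved_vector (a b c : R) (p : nat) (Ct Cx : jet -> R) : Prop :=
  diff_function Ct /\ diff_function Cx /\
  eq_on_solutions a b c p (fun z => Dtot_t Ct z + Dtot_x Cx z) (fun _ => 0).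

Definition trivial_conserved_vector (a b c : R) (p : nat)
    (Ct Cx : jet -> R) : Prop :=
  conserved_vector a b c p Ct Cx /\
  exists theta : jet -> R, diff_function theta /\
    eq_on_solutions a b c p Ct (Dtot_x theta) /\
    eq_on_solutions a b c p Cx (fun z => - Dtot_t theta z).

(* Functions of (t, x, u, v), in this order. *)
Definition pfun : Type := R -> R -> R -> R -> R.

Definition lift (h : pfun) : jet -> R := fun z => h (t_ z) (x_ z) (u_ z) (v_ z).

Record vfield : Type := VField { vfT : pfun; vfX : pfun; vfU : pfun; vfV : pfun }.

Definition Wu (X : vfield) (z : jet) : R :=
  lift (vfU X) z - lift (vfT X) z * u_t z - lift (vfX X) z * u_x z.

Definition Wv (X : vfield) (z : jet) : R :=
  lift (vfV X) z - lift (vfT X) z * v_t z - lift (vfX X) z * v_x z.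

Definition f (a b : R) (p : nat) (u v : R) : R :=
  a * (u ^ p + v ^ p) * u + b * (u * v) ^ p * v.

Definition g (a b : R) (p : nat) (u v : R) : R :=
  a * (u ^ p + v ^ p) * v + b * (u * v) ^ p * u.

(* h_u and h_v, as functions on jet space, for h = h(u,v). *)
Definition d_u (h : R -> R -> R) (z : jet) : R :=
  Derive (fun u => h u (v_ z)) (u_ z).

Definition d_v (h : R -> R -> R) (z : jet) : R :=
  Derive (fun v => h (u_ z) v) (v_ z).

Definition Ibragimov_t (X : vfield) (phi psi : pfun) (z : jet) : R :=
  lift phi z * Wu X z + lift psi z * Wv X z.

Definition Ibragimov_x (a b c : R) (p : nat) (X : vfield) (phi psi : pfun)
    (z : jet) : R :=
  lift phi z * (d_u (f a b p) z * Wu X z + d_v (f a b p) z * Wv X z)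
  + c * (lift phi z * Dtot_x (Dtot_x (Wu X)) z - Dtot_x (lift phi) z * Dtot_x (Wu X) z
         + Dtot_x (Dtot_x (lift phi)) z * Wu X z)
  + lift psi z * (d_u (g a b p) z * Wu X z + d_v (g a b p) z * Wv X z)
  + c * (lift psi z * Dtot_x (Dtot_x (Wv X)) z - Dtot_x (lift psi) z * Dtot_x (Wv X) z
         + Dtot_x (Dtot_x (lift psi)) z * Wv X z).

Definition provides (a b c : R) (p : nat) (X : vfield) (phi psi : pfun)
    (Ct Cx : jet -> R) : Prop :=
  exists (k : R) (Tt Tx : jet -> R),
    k <> 0 /\ trivial_conserved_vector a b c p Tt Tx /\
    eq_on_solutions a b c p (Ibragimov_t X phi psi) (fun z => k * Ct z + Tt z) /\
    eq_on_solutions a b c p (Ibragimov_x a b c p X phi psi)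
      (fun z => k * Cx z + Tx z).

Definition X1 (p : nat) : vfield :=
  VField (fun t x u v => 3 * t) (fun t x u v => x)
         (fun t x u v => - (1 / INR p) * u) (fun t x u v => - (1 / INR p) * v).

Definition Y1 (p : nat) : vfield :=
  VField (fun t x u v => 3 * t) (fun t x u v => x)
         (fun t x u v => - (2 / INR p) * u) (fun t x u v => - (2 / INR p) * v).

Definition X2 : vfield :=
  VField (fun t x u v => 1) (fun t x u v => 0)
         (fun t x u v => 0) (fun t x u v => 0).

(* Main.v *)
Require Import Defs.
From Stdlib Require Import Reals List Lia Lra FunctionalExtensionality.
From Coquelicot Require Import Coquelicot.
Open Scope R_scope.

(** Every conserved vector here is polynomial on jet space, and the whole
    statement reduces to polynomial identities at a single jet [z] with
    [F1 z = F2 z = 0]; no differential consequence of the system is ever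
    needed, because derivatives such as [u_tx] and [u_txx] are independent
    coordinates of the jet and cancel identically.

    Triviality is handled through a potential.  For polynomial [theta] the
    pair [(D_x theta, - D_t theta)] is a conserved vector since the total
    derivatives commute ([Dtot_comm]), so it suffices to exhibit [theta] and
    [k <> 0] with [C_X = k C + (D_x theta, - D_t theta)]
    ([provides_of_potential]).

    For the energy density [q = u^2 + v^2], multiply the equations by [u] and
    [v]: the result is a divergence exactly when [u df + v dg] is an exact
    differential [dK] ([energy_flux]), and then [q] is conserved with a flux
    [Q] formed from [K] and the dispersive term ([energy_conserved]).  Such a
    [K] exists when [a = 0] (proportional to [(uv)^(p+1)]) and when [b = 0],
    [p = 2] (proportional to [q^2]).  The dilation
    [3 t d_t + x d_x - m (u d_u + v d_v)] with multipliers [u, v] has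
    Ibragimov density [- m q - (3/2) t q_t - (1/2) x q_x].  Replacing [q_t] by
    [- Q_x] and integrating by parts in [x] leaves [(1/2 - m) q] and the
    potential [theta = (3 t Q - x q) / 2]; the flux matches when the dilation
    is a symmetry, which says that [K] scales like [u u_xx]
    ([scaling_provides_energy]).  This gives the constants [k] in both cases;
    in the first one [m = 1/p], whence the exclusion of [p = 2].

    For [b = 0], [p = 1] the sum [w = u + v] solves the single equation
    [w_t + (a w^2 + c w_xx)_x = 0], and the same computation applied to [w]
    yields [- (3/2) w^2] for the dilation.  For [d_t] with multiplier
    [2 a t w - x] the density is [- a t (w^2)_t + x w_t]: the first term is a
    total [x]-derivative, and the second becomes [a w^2] after one integration
    by parts, so here [a <> 0] matters. *)

(** * Polynomial functions on jet space *)

Inductive jet_polynomial : (jet -> R) -> Prop :=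
| jet_polynomial_const r : jet_polynomial (fun _ => r)
| jet_polynomial_coord k : jet_polynomial (fun z => z k)
| jet_polynomial_plus F G : jet_polynomial F -> jet_polynomial G ->
    jet_polynomial (fun z => F z + G z)
| jet_polynomial_mult F G : jet_polynomial F -> jet_polynomial G ->
    jet_polynomial (fun z => F z * G z).

Lemma jet_polynomial_opp F : jet_polynomial F -> jet_polynomial (fun z => - F z).
Proof.
  intros HF.
  replace (fun z => - F z) with (fun z => -1 * F z)
    by (apply functional_extensionality; intro z; ring).
  apply jet_polynomial_mult; [apply jet_polynomial_const | exact HF].
Qed.

Lemma jet_polynomial_minus F G : jet_polynomial F -> jet_polynomial G ->
  jet_polynomial (fun z => F z - G z).
Proof. intros HF HG. apply jet_polynomial_plus; [exact HF | apply jet_polynomial_opp, HG]. Qed.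

Lemma jet_polynomial_pow F n : jet_polynomial F -> jet_polynomial (fun z => F z ^ n).
Proof.
  intros HF; induction n as [|n IH]; simpl; [apply jet_polynomial_const | now apply jet_polynomial_mult].
Qed.

(** Partial derivatives are derivatives along [upd z k] and total derivatives
    are derivatives along the lines [z + s w z]; stating the chain rule for an
    arbitrary curve with velocity [w] treats both at once.  It is the
    polynomiality of the components of [w] that makes [G] polynomial. *)
Lemma jet_polynomial_derivation (w : jet -> jet) F :
  (forall k, jet_polynomial (fun z => w z k)) -> jet_polynomial F ->
  exists G, jet_polynomial G /\
    forall (gamma : R -> jet) s,
      (forall k, is_derive (fun r => gamma r k) s (w (gamma s) k)) ->
      is_derive (fun r => F (gamma r)) s (G (gamma s)).
Proof.
  intros Hw HF.
  induction HF as [r | k | F1 F2 HF1 (G1 & P1 & D1) HF2 (G2 & P2 & D2)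
                  | F1 F2 HF1 (G1 & P1 & D1) HF2 (G2 & P2 & D2)].
  - exists (fun _ => 0); split; [apply jet_polynomial_const|].
    intros gamma s _. apply (@is_derive_const R_AbsRing R_NormedModule).
  - exists (fun z => w z k); split; [apply Hw|]. intros gamma s H; apply H.
  - exists (fun z => G1 z + G2 z); split; [now apply jet_polynomial_plus|].
    intros gamma s H.
    apply (@is_derive_plus R_AbsRing R_NormedModule); [now apply D1 | now apply D2].
  - exists (fun z => G1 z * F2 z + F1 z * G2 z); split;
      [apply jet_polynomial_plus; now apply jet_polynomial_mult|].
    intros gamma s H. apply (is_derive_mult (fun r => F1 (gamma r)));
      [now apply D1 | now apply D2 | exact Rmult_comm].
Qed.

(** The common form of [Dtot_t] and [Dtot_x], to which both are convertible. *)
Definition derive_along (w : jet -> jet) (F : jet -> R) : jet -> R :=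
  fun z => Derive (fun s => F (fun k => z k + s * w z k)) 0.

Lemma line_origin (z d : jet) : (fun k => z k + 0 * d k) = z.
Proof. apply functional_extensionality; intro k; ring. Qed.

Lemma jet_polynomial_derive_along w F :
  (forall k, jet_polynomial (fun z => w z k)) -> jet_polynomial F ->
  jet_polynomial (derive_along w F) /\
  forall z, is_derive (fun s => F (fun k => z k + s * w z k)) 0 (derive_along w F z).
Proof.
  intros Hw HF.
  destruct (jet_polynomial_derivation w F Hw HF) as (G & HG & D).
  assert (E : forall z, is_derive (fun s => F (fun k => z k + s * w z k)) 0 (G z)).
  { intro z. specialize (D (fun s k => z k + s * w z k) 0). cbv beta in D.
    rewrite line_origin in D. apply D.
    intro k. auto_derive; [trivial | ring]. }
  replace (derive_along w F) with G; [now split|].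
  apply functional_extensionality; intro z. symmetry. apply is_derive_unique, E.
Qed.

Lemma upd_same z k : upd z k (z k) = z.
Proof.
  apply functional_extensionality; intro l. unfold upd.
  destruct (coord_eq_dec l k) as [->|]; reflexivity.
Qed.

Lemma jet_polynomial_pd k F : jet_polynomial F ->
  jet_polynomial (pd k F) /\
  forall z, is_derive (fun s => F (upd z k s)) (z k) (pd k F z).
Proof.
  intros HF.
  pose (w := fun (_ : jet) l => if coord_eq_dec l k then 1 else 0).
  destruct (jet_polynomial_derivation w F) as (G & HG & D);
    [intro l; exact (jet_polynomial_const (if coord_eq_dec l k then 1 else 0)) | exact HF |].
  assert (E : forall z, is_derive (fun s => F (upd z k s)) (z k) (G z)).
  { intro z. specialize (D (upd z k) (z k)). rewrite upd_same in D. apply D.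
    intro l. unfold upd, w. destruct (coord_eq_dec l k).
    - apply (@is_derive_id R_AbsRing).
    - apply (@is_derive_const R_AbsRing R_NormedModule). }
  replace (pd k F) with G; [now split|].
  apply functional_extensionality; intro z. symmetry. apply is_derive_unique, E.
Qed.

(** Evaluation at a coordinate is nonexpansive for the uniform distance, and
    sums and products preserve continuity. *)
Lemma jet_polynomial_continuous F z : jet_polynomial F -> continuous F z.
Proof.
  induction 1 as [r | k | F G _ IF _ IG | F G _ IF _ IG].
  - apply continuous_const.
  - intros P [e He]. exists e. intros y Hy. apply He, Hy.
  - now apply (continuous_plus F G).
  - now apply (continuous_mult F G).
Qed.

Lemma jet_polynomial_finite_order F : jet_polynomial F -> finite_order F.
Proof.
  assert (mono : forall m n k, (m <= n)%nat -> order_le m k -> order_le n k)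
    by (intros m n [| |i j|i j]; simpl; trivial; lia).
  induction 1 as [r | k | F G _ [m IF] _ [n IG] | F G _ [m IF] _ [n IG]].
  - exists 0%nat. reflexivity.
  - destruct k as [| |i j|i j];
      [exists 0%nat | exists 0%nat | exists (i + j)%nat | exists (i + j)%nat];
      intros z z' H; apply H; simpl; trivial.
  - exists (Nat.max m n). intros z z' H.
    rewrite (IF z z'), (IG z z'); [reflexivity | |];
      intros k Hk; apply H; revert Hk; apply mono; lia.
  - exists (Nat.max m n). intros z z' H.
    rewrite (IF z z'), (IG z z'); [reflexivity | |];
      intros k Hk; apply H; revert Hk; apply mono; lia.
Qed.

(** Partial derivatives stay in the class, so smoothness reduces to continuity
    and differentiability of its members. *)
Lemma jet_polynomial_diff_function F : jet_polynomial F -> diff_function F.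
Proof.
  intros HF. split; [now apply jet_polynomial_finite_order|].
  intro l.
  assert (Hl : jet_polynomial (pds l F))
    by (induction l; [exact HF | now apply jet_polynomial_pd]).
  intro z; split; [now apply jet_polynomial_continuous|].
  intro k. eexists. now apply jet_polynomial_pd.
Qed.

(** * Total derivatives and trivial conserved vectors *)

Lemma vec_t_polynomial k : jet_polynomial (fun z => vec_t z k).
Proof. destruct k; simpl; (apply jet_polynomial_const || apply jet_polynomial_coord). Qed.

Lemma vec_x_polynomial k : jet_polynomial (fun z => vec_x z k).
Proof. destruct k; simpl; (apply jet_polynomial_const || apply jet_polynomial_coord). Qed.

Lemma jet_polynomial_Dtot_t F : jet_polynomial F -> jet_polynomial (Dtot_t F).
Proof. intro HF. now apply (jet_polynomial_derive_along vec_t); [apply vec_t_polynomial|]. Qed.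

Lemma jet_polynomial_Dtot_x F : jet_polynomial F -> jet_polynomial (Dtot_x F).
Proof. intro HF. now apply (jet_polynomial_derive_along vec_x); [apply vec_x_polynomial|]. Qed.

Lemma derive_along_coord w k : derive_along w (fun z => z k) = fun z => w z k.
Proof.
  apply functional_extensionality; intro z. apply is_derive_unique.
  auto_derive; [trivial | ring].
Qed.

Lemma derive_along_const w r : derive_along w (fun _ => r) = fun _ => 0.
Proof. apply functional_extensionality; intro z. exact (Derive_const r 0). Qed.

Lemma derive_along_plus w F G :
  (forall k, jet_polynomial (fun z => w z k)) ->
  jet_polynomial F -> jet_polynomial G ->
  derive_along w (fun z => F z + G z)
  = fun z => derive_along w F z + derive_along w G z.
Proof.
  intros Hw HF HG. apply functional_extensionality; intro z.
  apply (Derive_plus (fun s => F (fun k => z k + s * w z k)));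
    eexists; now apply jet_polynomial_derive_along.
Qed.

Lemma derive_along_mult w F G :
  (forall k, jet_polynomial (fun z => w z k)) ->
  jet_polynomial F -> jet_polynomial G ->
  derive_along w (fun z => F z * G z)
  = fun z => derive_along w F z * G z + F z * derive_along w G z.
Proof.
  intros Hw HF HG. apply functional_extensionality; intro z.
  unfold derive_along at 1.
  rewrite (Derive_mult (fun s => F (fun k => z k + s * w z k)))
    by (eexists; now apply jet_polynomial_derive_along).
  cbv beta. rewrite line_origin. reflexivity.
Qed.

(** The commutator of two derivations is a derivation, so it vanishes on all
    polynomials as soon as it vanishes on the coordinates. *)
Lemma derive_along_comm w1 w2 F :
  (forall k, jet_polynomial (fun z => w1 z k)) ->
  (forall k, jet_polynomial (fun z => w2 z k)) ->
  (forall k, derive_along w1 (fun z => w2 z k) = derive_along w2 (fun z => w1 z k)) ->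
  jet_polynomial F ->
  derive_along w1 (derive_along w2 F) = derive_along w2 (derive_along w1 F).
Proof.
  intros H1 H2 H12.
  assert (P1 : forall F, jet_polynomial F -> jet_polynomial (derive_along w1 F))
    by (intros; now apply jet_polynomial_derive_along).
  assert (P2 : forall F, jet_polynomial F -> jet_polynomial (derive_along w2 F))
    by (intros; now apply jet_polynomial_derive_along).
  induction 1 as [r | k | F G HF IF HG IG | F G HF IF HG IG].
  - now rewrite !derive_along_const.
  - rewrite !derive_along_coord. apply H12.
  - rewrite !derive_along_plus by auto. now rewrite IF, IG.
  - rewrite (derive_along_mult w1 F), (derive_along_mult w2 F) by assumption.
    rewrite !derive_along_plus by (auto; apply jet_polynomial_mult; auto).
    rewrite !derive_along_mult by auto. rewrite IF, IG.
    apply functional_extensionality; intro z. ring.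
Qed.

Lemma Dtot_comm F : jet_polynomial F -> Dtot_t (Dtot_x F) = Dtot_x (Dtot_t F).
Proof.
  apply (derive_along_comm vec_t vec_x);
    [apply vec_t_polynomial | apply vec_x_polynomial |].
  intros [| |i j|i j]; simpl; rewrite ?derive_along_const, ?derive_along_coord;
    reflexivity.
Qed.

(** The jet of a solution is a zero of [F1] and [F2], so an identity on the
    zero set in jet space is stronger than one on solutions. *)
Lemma conserved_vector_of_jet_identity a b c p Ct Cx :
  jet_polynomial Ct -> jet_polynomial Cx ->
  (forall z, F1 a b c p z = 0 -> F2 a b c p z = 0 -> Dtot_t Ct z + Dtot_x Cx z = 0) ->
  conserved_vector a b c p Ct Cx.
Proof.
  intros Ht Hx H. repeat split; try now apply jet_polynomial_diff_function.
  intros O u v [_ S] t x Htx. destruct (S t x Htx) as (_ & _ & E1 & E2). now apply H.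
Qed.

Lemma trivial_of_potential a b c p theta : jet_polynomial theta ->
  trivial_conserved_vector a b c p (Dtot_x theta) (fun z => - Dtot_t theta z).
Proof.
  intros H. split.
  - apply conserved_vector_of_jet_identity.
    + now apply jet_polynomial_Dtot_x.
    + now apply jet_polynomial_opp, jet_polynomial_Dtot_t.
    + intros z _ _. rewrite Dtot_comm by assumption.
      unfold Dtot_x at 2. rewrite Derive_opp. apply Rplus_opp_r.
  - exists theta. split; [now apply jet_polynomial_diff_function|].
    split; intros O u v _ t x _; reflexivity.
Qed.

Lemma provides_of_potential a b c p X phi psi Ct Cx k theta :
  k <> 0 -> jet_polynomial theta ->
  (forall z, F1 a b c p z = 0 -> F2 a b c p z = 0 ->
    Ibragimov_t X phi psi z = k * Ct z + Dtot_x theta z /\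
    Ibragimov_x a b c p X phi psi z = k * Cx z - Dtot_t theta z) ->
  provides a b c p X phi psi Ct Cx.
Proof.
  intros Hk Hth H.
  exists k, (Dtot_x theta), (fun z => - Dtot_t theta z).
  split; [exact Hk|]. split; [now apply trivial_of_potential|].
  split; intros O u v [_ S] t x Htx; destruct (S t x Htx) as (_ & _ & E1 & E2);
    now apply H.
Qed.

(** * Explicit derivatives *)

Ltac jet_unfold :=
  cbv beta iota delta [t_ x_ u_ u_t u_x u_xxx v_ v_t v_x v_xxx vec_t vec_x lift Wu Wv
       vfT vfX vfU vfV X2].

(* For a power with exponent [S n] the derivative carries the factor
   [INR (S n)], which [simpl] turns into a match on [n]; fold it back before
   splitting it as [INR n + 1]. *)
Ltac pow_field :=
  simpl;
  repeat match goal with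
  | |- context [match ?n with O => 1 | S _ => INR ?n + 1 end] =>
      change (match n with O => 1 | S _ => INR n + 1 end) with (INR (S n))
  end;
  rewrite ?S_INR; field.

(* The derivative is taken at [s = 0], so its value contains [z k + 0 * _];
   these must be cleaned up first because powers with a variable exponent are
   atoms for [field]. *)
Ltac total_derivative :=
  apply functional_extensionality; intro; apply is_derive_unique; jet_unfold;
  auto_derive; [repeat split; trivial | rewrite ?Rmult_0_l, ?Rplus_0_r; pow_field].

Ltac jet_poly :=
  repeat first
    [ apply jet_polynomial_const | apply jet_polynomial_coord
    | apply jet_polynomial_plus | apply jet_polynomial_minus
    | apply jet_polynomial_opp | apply jet_polynomial_mult
    | apply jet_polynomial_pow | assumption ].

(** Both [X1 p] and [Y1 p] belong to this family, with [m = 1 / p] and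
    [m = 2 / p]. *)
Definition scaling (m : R) : vfield :=
  VField (fun t x u v => 3 * t) (fun t x u v => x)
         (fun t x u v => - m * u) (fun t x u v => - m * v).

Lemma Dx_Wu_scaling m : Dtot_x (Wu (scaling m)) =
  fun z => - (m + 1) * u_x z - 3 * t_ z * z (cu 1 1) - x_ z * z (cu 0 2).
Proof. unfold scaling. total_derivative. Qed.

Lemma Dx_Wv_scaling m : Dtot_x (Wv (scaling m)) =
  fun z => - (m + 1) * v_x z - 3 * t_ z * z (cv 1 1) - x_ z * z (cv 0 2).
Proof. unfold scaling. total_derivative. Qed.

Lemma Dxx_Wu_scaling m : Dtot_x (Dtot_x (Wu (scaling m))) =
  fun z => - (m + 2) * z (cu 0 2) - 3 * t_ z * z (cu 1 2) - x_ z * u_xxx z.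
Proof. rewrite Dx_Wu_scaling. total_derivative. Qed.

Lemma Dxx_Wv_scaling m : Dtot_x (Dtot_x (Wv (scaling m))) =
  fun z => - (m + 2) * z (cv 0 2) - 3 * t_ z * z (cv 1 2) - x_ z * v_xxx z.
Proof. rewrite Dx_Wv_scaling. total_derivative. Qed.

Lemma Dx_lift_u : Dtot_x (lift (fun t x u v => u)) = u_x.
Proof. total_derivative. Qed.

Lemma Dx_lift_v : Dtot_x (lift (fun t x u v => v)) = v_x.
Proof. total_derivative. Qed.

Lemma Dxx_lift_u : Dtot_x (Dtot_x (lift (fun t x u v => u))) = fun z => z (cu 0 2).
Proof. rewrite Dx_lift_u. total_derivative. Qed.

Lemma Dxx_lift_v : Dtot_x (Dtot_x (lift (fun t x u v => v))) = fun z => z (cv 0 2).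
Proof. rewrite Dx_lift_v. total_derivative. Qed.

Lemma Dxx_energy : Dtot_x (Dtot_x (fun z => u_ z ^ 2 + v_ z ^ 2)) =
  fun z => 2 * (u_ z * z (cu 0 2) + u_x z ^ 2 + v_ z * z (cv 0 2) + v_x z ^ 2).
Proof.
  replace (Dtot_x (fun z => u_ z ^ 2 + v_ z ^ 2))
    with (fun z => 2 * (u_ z * u_x z + v_ z * v_x z)); [|symmetry]; total_derivative.
Qed.

Lemma d_u_f a b n z : d_u (Defs.f a b (S n)) z =
  a * ((INR n + 2) * u_ z ^ S n + v_ z ^ S n)
  + b * (INR n + 1) * (u_ z * v_ z) ^ n * v_ z ^ 2.
Proof.
  unfold d_u, Defs.f. apply is_derive_unique. auto_derive; [trivial | pow_field].
Qed.

Lemma d_v_f a b n z : d_v (Defs.f a b (S n)) z =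
  a * (INR n + 1) * v_ z ^ n * u_ z
  + b * (INR n + 2) * (u_ z * v_ z) ^ S n.
Proof.
  unfold d_v, Defs.f. apply is_derive_unique. auto_derive; [trivial | pow_field].
Qed.

Lemma d_u_g a b n z : d_u (g a b (S n)) z =
  a * (INR n + 1) * u_ z ^ n * v_ z
  + b * (INR n + 2) * (u_ z * v_ z) ^ S n.
Proof.
  unfold d_u, g. apply is_derive_unique. auto_derive; [trivial | pow_field].
Qed.

Lemma d_v_g a b n z : d_v (g a b (S n)) z =
  a * ((INR n + 2) * v_ z ^ S n + u_ z ^ S n)
  + b * (INR n + 1) * (u_ z * v_ z) ^ n * u_ z ^ 2.
Proof.
  unfold d_v, g. apply is_derive_unique. auto_derive; [trivial | pow_field].
Qed.

(** Expressing the fluxes through the same partial derivatives [d_u], [d_v]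
    that occur in Ibragimov's formulas keeps them as atoms in the identities
    below, whatever [f] and [g] are. *)
Lemma F1_chain_rule a b c n z : F1 a b c (S n) z =
  u_t z + (d_u (Defs.f a b (S n)) z * u_x z + d_v (Defs.f a b (S n)) z * v_x z) + c * u_xxx z.
Proof.
  unfold F1. rewrite d_u_f, d_v_f.
  replace (Dtot_x (fun z => (u_ z ^ S n + v_ z ^ S n) * u_ z)) with
    (fun z => ((INR n + 2) * u_ z ^ S n + v_ z ^ S n) * u_x z
              + (INR n + 1) * v_ z ^ n * u_ z * v_x z)
    by (symmetry; total_derivative).
  replace (Dtot_x (fun z => (u_ z * v_ z) ^ S n * v_ z)) with
    (fun z => (INR n + 1) * (u_ z * v_ z) ^ n * v_ z ^ 2 * u_x z
              + (INR n + 2) * (u_ z * v_ z) ^ S n * v_x z)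
    by (symmetry; total_derivative).
  ring.
Qed.

Lemma F2_chain_rule a b c n z : F2 a b c (S n) z =
  v_t z + (d_u (g a b (S n)) z * u_x z + d_v (g a b (S n)) z * v_x z) + c * v_xxx z.
Proof.
  unfold F2. rewrite d_u_g, d_v_g.
  replace (Dtot_x (fun z => (u_ z ^ S n + v_ z ^ S n) * v_ z)) with
    (fun z => ((INR n + 2) * v_ z ^ S n + u_ z ^ S n) * v_x z
              + (INR n + 1) * u_ z ^ n * v_ z * u_x z)
    by (symmetry; total_derivative).
  replace (Dtot_x (fun z => (u_ z * v_ z) ^ S n * u_ z)) with
    (fun z => (INR n + 1) * (u_ z * v_ z) ^ n * u_ z ^ 2 * v_x z
              + (INR n + 2) * (u_ z * v_ z) ^ S n * u_x z)
    by (symmetry; total_derivative).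
  ring.
Qed.

(** * The energy u^2 + v^2 *)

(** [K] is a function of [u, v] with [dK = u df + v dg].  Derivatives along
    arbitrary directions [w] cover [D_t K] and [D_x K] in one hypothesis. *)
Definition energy_flux (a b : R) (p : nat) (K : jet -> R) : Prop :=
  forall w z, derive_along w K z =
    (u_ z * d_u (Defs.f a b p) z + v_ z * d_u (g a b p) z) * w z (cu 0 0)
    + (u_ z * d_v (Defs.f a b p) z + v_ z * d_v (g a b p) z) * w z (cv 0 0).

(** The function whose [x]-derivative is [2 (u u_xxx + v v_xxx)]. *)
Definition dispersion_flux (z : jet) : R :=
  2 * u_ z * z (cu 0 2) + 2 * v_ z * z (cv 0 2) - u_x z ^ 2 - v_x z ^ 2.

Lemma dispersion_flux_eq z :
  Dtot_x (Dtot_x (fun z => u_ z ^ 2 + v_ z ^ 2)) z - 3 * (u_x z ^ 2 + v_x z ^ 2)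
  = dispersion_flux z.
Proof. rewrite Dxx_energy. unfold dispersion_flux. ring. Qed.

(** The divergence equals [2 r (u F1 + v F2)]. *)
Lemma energy_conserved a b c p K r :
  (1 <= p)%nat -> jet_polynomial K -> energy_flux a b p K ->
  conserved_vector a b c p (fun z => r * (u_ z ^ 2 + v_ z ^ 2))
    (fun z => 2 * r * K z + r * c * dispersion_flux z).
Proof.
  intros hp HK D. destruct p as [|n]; [lia|].
  unfold dispersion_flux.
  apply conserved_vector_of_jet_identity; [jet_poly | jet_poly |].
  intros z E1 E2. rewrite F1_chain_rule in E1. rewrite F2_chain_rule in E2.
  replace (Dtot_t (fun z => r * (u_ z ^ 2 + v_ z ^ 2))) with
    (fun z => 2 * r * (u_ z * u_t z + v_ z * v_t z)) by (symmetry; total_derivative).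
  rewrite (derive_along_plus vec_x), derive_along_mult, derive_along_const
    by (try apply vec_x_polynomial; jet_poly).
  rewrite D.
  replace (derive_along vec_x (fun z => r * c *
      (2 * u_ z * z (cu 0 2) + 2 * v_ z * z (cv 0 2) - u_x z ^ 2 - v_x z ^ 2)))
    with (fun z => 2 * r * c * (u_ z * u_xxx z + v_ z * v_xxx z))
    by (symmetry; total_derivative).
  apply (f_equal (Rmult (2 * r * u_ z))) in E1.
  apply (f_equal (Rmult (2 * r * v_ z))) in E2.
  unfold u_x, v_x in *; simpl; lra.
Qed.

(** The hypothesis relating [m] and [K] compares weights: [m] times the Euler
    operator maps [K] to [2 (m + 1) K], so that [K] has the weight
    [2 m + 2] of [u u_xx] and the dilation is a symmetry.  The potential is
    half of [3 t Q - x q], where [Q] is the flux of [q]. *)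
Lemma scaling_provides_energy a b c p K r m :
  (1 <= p)%nat -> jet_polynomial K -> energy_flux a b p K ->
  (forall z, m * ((u_ z * d_u (Defs.f a b p) z + v_ z * d_u (g a b p) z) * u_ z
                  + (u_ z * d_v (Defs.f a b p) z + v_ z * d_v (g a b p) z) * v_ z)
             = 2 * (m + 1) * K z) ->
  r <> 0 -> m <> / 2 ->
  provides a b c p (scaling m) (fun t x u v => u) (fun t x u v => v)
    (fun z => r * (u_ z ^ 2 + v_ z ^ 2))
    (fun z => 2 * r * K z + r * c * dispersion_flux z).
Proof.
  intros hp HK D HW Hr Hm. destruct p as [|n]; [lia|].
  (* The part of the potential that does not involve the abstract [K]. *)
  pose (rest := fun z => 3 / 2 * c * t_ z * dispersion_flux z
                         - / 2 * x_ z * (u_ z ^ 2 + v_ z ^ 2)).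
  assert (Hrest : jet_polynomial rest)
    by (unfold rest, dispersion_flux, Rdiv; jet_poly).
  assert (Dtheta : forall w, (forall k, jet_polynomial (fun z => w z k)) ->
    derive_along w (fun z => 3 * t_ z * K z + rest z) =
    fun z => 3 * w z ct * K z + 3 * t_ z * derive_along w K z
             + derive_along w rest z).
  { intros w Hw. rewrite derive_along_plus, derive_along_mult by jet_poly.
    replace (derive_along w (fun z => 3 * t_ z)) with (fun z => 3 * w z ct)
      by (symmetry; total_derivative). reflexivity. }
  apply provides_of_potential with
    (k := (/ 2 - m) / r) (theta := fun z => 3 * t_ z * K z + rest z).
  - apply Rmult_integral_contrapositive_currified;
      [lra | now apply Rinv_neq_0_compat].
  - jet_poly.
  - intros z E1 E2. rewrite F1_chain_rule in E1. rewrite F2_chain_rule in E2.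
    replace ((/ 2 - m) / r * (2 * r * K z + r * c * dispersion_flux z))
      with ((/ 2 - m) * (2 * K z + c * dispersion_flux z)) by (field; exact Hr).
    replace ((/ 2 - m) / r * (r * (u_ z ^ 2 + v_ z ^ 2)))
      with ((/ 2 - m) * (u_ z ^ 2 + v_ z ^ 2)) by (field; exact Hr).
    change Dtot_t with (derive_along vec_t).
    split.
    + change Dtot_x with (derive_along vec_x).
      rewrite Dtheta by apply vec_x_polynomial. rewrite D.
      replace (derive_along vec_x rest) with (fun z =>
        3 * c * t_ z * (u_ z * u_xxx z + v_ z * v_xxx z)
        - / 2 * (u_ z ^ 2 + v_ z ^ 2) - x_ z * (u_ z * u_x z + v_ z * v_x z))
        by (symmetry; unfold rest, dispersion_flux; total_derivative).
      unfold Ibragimov_t. unfold scaling, Wu, Wv, lift; simpl.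
      apply (f_equal (Rmult (3 * t_ z * u_ z))) in E1.
      apply (f_equal (Rmult (3 * t_ z * v_ z))) in E2.
      unfold u_x, v_x in *; lra.
    + rewrite Dtheta by apply vec_t_polynomial. rewrite D.
      replace (derive_along vec_t rest) with (fun z =>
        3 / 2 * c * dispersion_flux z
        + 3 * c * t_ z * (u_t z * z (cu 0 2) + u_ z * z (cu 1 2) - u_x z * z (cu 1 1)
                          + v_t z * z (cv 0 2) + v_ z * z (cv 1 2) - v_x z * z (cv 1 1))
        - x_ z * (u_ z * u_t z + v_ z * v_t z))
        by (symmetry; unfold rest, dispersion_flux; total_derivative).
      unfold Ibragimov_x.
      rewrite Dxx_Wu_scaling, Dxx_Wv_scaling, Dx_Wu_scaling, Dx_Wv_scaling,
        Dxx_lift_u, Dxx_lift_v, Dx_lift_u, Dx_lift_v.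
      specialize (HW z).
      unfold scaling, Wu, Wv, lift, dispersion_flux; simpl.
      apply (f_equal (Rmult (x_ z * u_ z))) in E1.
      apply (f_equal (Rmult (x_ z * v_ z))) in E2.
      unfold u_t, v_t in *; lra.
Qed.

(** Here [p = S n], so the coefficient is [b (2 p + 1) / (p + 1)]. *)
Lemma product_energy_flux b n : energy_flux 0 b (S n)
  (fun z => b * (2 * INR n + 3) / (INR n + 2) * (u_ z * v_ z) ^ S (S n)).
Proof.
  intros w z. rewrite d_u_f, d_v_f, d_u_g, d_v_g.
  assert (INR n + 2 <> 0) by (pose proof (pos_INR n); lra).
  apply is_derive_unique. jet_unfold. auto_derive; [trivial|].
  rewrite ?Rmult_0_l, ?Rplus_0_r. pow_field. assumption.
Qed.

Lemma quartic_energy_flux a : energy_flux a 0 2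
  (fun z => 3 / 4 * a * (u_ z ^ 2 + v_ z ^ 2) ^ 2).
Proof.
  intros w z. rewrite d_u_f, d_v_f, d_u_g, d_v_g.
  apply is_derive_unique. jet_unfold. auto_derive; [trivial|].
  rewrite ?Rmult_0_l, ?Rplus_0_r. pow_field.
Qed.

(** * The sum u + v for p = 1 and b = 0 *)

(** For [p = 1], [b = 0] the nonlinearities add up to [f + g = a (u + v)^2]. *)
Lemma F1_plus_F2_p1 a c z : F1 a 0 c 1 z = 0 -> F2 a 0 c 1 z = 0 ->
  u_t z + v_t z + 2 * a * (u_ z + v_ z) * (u_x z + v_x z)
  + c * (u_xxx z + v_xxx z) = 0.
Proof.
  rewrite F1_chain_rule, F2_chain_rule, d_u_f, d_v_f, d_u_g, d_v_g.
  intros E1 E2. simpl in *. lra.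
Qed.

Lemma sum_flux_eq z :
  Dtot_x (Dtot_x (fun z => (u_ z + v_ z) ^ 2)) z - 3 * (u_x z + v_x z) ^ 2
  = 2 * (u_ z + v_ z) * (z (cu 0 2) + z (cv 0 2)) - (u_x z + v_x z) ^ 2.
Proof.
  replace (Dtot_x (fun z => (u_ z + v_ z) ^ 2))
    with (fun z => 2 * (u_ z + v_ z) * (u_x z + v_x z)) by (symmetry; total_derivative).
  replace (Dtot_x (fun z => 2 * (u_ z + v_ z) * (u_x z + v_x z)))
    with (fun z => 2 * (u_x z + v_x z) ^ 2
                   + 2 * (u_ z + v_ z) * (z (cu 0 2) + z (cv 0 2)))
    by (symmetry; total_derivative).
  ring.
Qed.

Definition sum_density (z : jet) : R := 3 * (u_ z + v_ z) ^ 2.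

Definition sum_flux (a c : R) (z : jet) : R :=
  4 * a * (u_ z + v_ z) ^ 3
  + 3 * c * (2 * (u_ z + v_ z) * (z (cu 0 2) + z (cv 0 2)) - (u_x z + v_x z) ^ 2).

(** The divergence is [6 (u + v) (F1 + F2)]. *)
Lemma sum_conserved a c : conserved_vector a 0 c 1 sum_density (sum_flux a c).
Proof.
  apply conserved_vector_of_jet_identity; unfold sum_density, sum_flux;
    [jet_poly | jet_poly |].
  intros z E1 E2. pose proof (F1_plus_F2_p1 a c z E1 E2) as E. clear E1 E2.
  replace (Dtot_t (fun z => 3 * (u_ z + v_ z) ^ 2)) with
    (fun z => 6 * (u_ z + v_ z) * (u_t z + v_t z)) by (symmetry; total_derivative).
  match goal with |- context [Dtot_x ?F] =>
    replace (Dtot_x F) with (fun z =>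
      12 * a * (u_ z + v_ z) ^ 2 * (u_x z + v_x z)
      + 6 * c * (u_ z + v_ z) * (u_xxx z + v_xxx z)) by (symmetry; total_derivative)
  end.
  apply (f_equal (Rmult (6 * (u_ z + v_ z)))) in E. lra.
Qed.

Lemma Dx_lift_sum : Dtot_x (lift (fun t x u v => u + v)) = fun z => u_x z + v_x z.
Proof. total_derivative. Qed.

Lemma Dxx_lift_sum : Dtot_x (Dtot_x (lift (fun t x u v => u + v))) =
  fun z => z (cu 0 2) + z (cv 0 2).
Proof. rewrite Dx_lift_sum. total_derivative. Qed.

(** The density [w (- 2 w - 3 t w_t - x w_x)] reduces to [(- 2 + 1/2) w^2],
    which is [- 1/2] times [sum_density]; the potential is again half of
    [3 t Q - x w^2], with [sum_flux] equal to [3 Q]. *)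
Lemma scaling_provides_sum a c :
  provides a 0 c 1 (scaling 2) (fun t x u v => u + v) (fun t x u v => u + v)
    sum_density (sum_flux a c).
Proof.
  apply provides_of_potential with (k := - / 2) (theta := fun z =>
    / 2 * (t_ z * sum_flux a c z - x_ z * (u_ z + v_ z) ^ 2)).
  - lra.
  - unfold sum_flux. jet_poly.
  - intros z E1 E2. pose proof (F1_plus_F2_p1 a c z E1 E2) as E. clear E1 E2.
    split.
    + match goal with |- context [Dtot_x ?F] =>
        replace (Dtot_x F) with (fun z =>
          t_ z * (6 * a * (u_ z + v_ z) ^ 2 * (u_x z + v_x z)
                  + 3 * c * (u_ z + v_ z) * (u_xxx z + v_xxx z))
          - / 2 * (u_ z + v_ z) ^ 2 - x_ z * (u_ z + v_ z) * (u_x z + v_x z))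
          by (symmetry; unfold sum_flux; total_derivative)
      end.
      unfold Ibragimov_t, scaling, Wu, Wv, lift, sum_density; simpl.
      apply (f_equal (Rmult (3 * t_ z * (u_ z + v_ z)))) in E. lra.
    + match goal with |- context [Dtot_t ?F] =>
        replace (Dtot_t F) with (fun z =>
          / 2 * sum_flux a c z
          + t_ z * (6 * a * (u_ z + v_ z) ^ 2 * (u_t z + v_t z)
                    + 3 * c * ((u_t z + v_t z) * (z (cu 0 2) + z (cv 0 2))
                               + (u_ z + v_ z) * (z (cu 1 2) + z (cv 1 2))
                               - (u_x z + v_x z) * (z (cu 1 1) + z (cv 1 1))))
          - x_ z * (u_ z + v_ z) * (u_t z + v_t z))
          by (symmetry; unfold sum_flux; total_derivative)
      end.
      unfold Ibragimov_x.
      rewrite Dxx_Wu_scaling, Dxx_Wv_scaling, Dx_Wu_scaling, Dx_Wv_scaling,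
        Dxx_lift_sum, Dx_lift_sum, d_u_f, d_v_f, d_u_g, d_v_g.
      unfold scaling, Wu, Wv, lift, sum_flux; simpl.
      apply (f_equal (Rmult (x_ z * (u_ z + v_ z)))) in E. lra.
Qed.

(** The [x]-derivative of the multiplier [2 a t w - x] is, up to sign, the
    characteristic [1 - 2 a t w_x] of the Galilean invariance
    [w -> w + e, x -> x + 2 a e t] of the equation for [w]. *)
Lemma Dx_lift_galilean a :
  Dtot_x (lift (fun t x u v => 2 * a * t * (u + v) - x)) =
  fun z => 2 * a * t_ z * (u_x z + v_x z) - 1.
Proof. total_derivative. Qed.

Lemma Dxx_lift_galilean a :
  Dtot_x (Dtot_x (lift (fun t x u v => 2 * a * t * (u + v) - x))) =
  fun z => 2 * a * t_ z * (z (cu 0 2) + z (cv 0 2)).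
Proof. rewrite Dx_lift_galilean. total_derivative. Qed.

Lemma Dx_Wu_X2 : Dtot_x (Wu X2) = fun z => - z (cu 1 1).
Proof. total_derivative. Qed.

Lemma Dx_Wv_X2 : Dtot_x (Wv X2) = fun z => - z (cv 1 1).
Proof. total_derivative. Qed.

Lemma Dxx_Wu_X2 : Dtot_x (Dtot_x (Wu X2)) = fun z => - z (cu 1 2).
Proof. rewrite Dx_Wu_X2. total_derivative. Qed.

Lemma Dxx_Wv_X2 : Dtot_x (Dtot_x (Wv X2)) = fun z => - z (cv 1 2).
Proof. rewrite Dx_Wv_X2. total_derivative. Qed.

(** In the density [- 2 a t w w_t + x w_t] the first term is [a t Q_x] with
    [3 Q] equal to [sum_flux], and [x w_t = - x (a w^2 + c w_xx)_x] equals
    [a w^2 + c w_xx] up to [D_x (- x (a w^2 + c w_xx))]; finally [c w_xx] is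
    [D_x (c w_x)].  The potential collects these three terms, and the remaining
    [a w^2] is [a / 3] times [sum_density]. *)
Lemma time_translation_provides_sum a c : a <> 0 ->
  provides a 0 c 1 X2 (fun t x u v => 2 * a * t * (u + v) - x)
    (fun t x u v => 2 * a * t * (u + v) - x) sum_density (sum_flux a c).
Proof.
  intros Ha.
  apply provides_of_potential with (k := a * / 3) (theta := fun z =>
    a * / 3 * t_ z * sum_flux a c z
    - x_ z * (a * (u_ z + v_ z) ^ 2 + c * (z (cu 0 2) + z (cv 0 2)))
    + c * (u_x z + v_x z)).
  - apply Rmult_integral_contrapositive_currified; [exact Ha | lra].
  - unfold sum_flux. jet_poly.
  - intros z E1 E2. pose proof (F1_plus_F2_p1 a c z E1 E2) as E. clear E1 E2.
    split.
    + match goal with |- context [Dtot_x ?F] =>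
        replace (Dtot_x F) with (fun z =>
          a * t_ z * (4 * a * (u_ z + v_ z) ^ 2 * (u_x z + v_x z)
                      + 2 * c * (u_ z + v_ z) * (u_xxx z + v_xxx z))
          - a * (u_ z + v_ z) ^ 2
          - x_ z * (2 * a * (u_ z + v_ z) * (u_x z + v_x z)
                    + c * (u_xxx z + v_xxx z)))
          by (symmetry; unfold sum_flux; total_derivative)
      end.
      unfold Ibragimov_t, X2, Wu, Wv, lift, sum_density; simpl.
      apply (f_equal (Rmult (2 * a * t_ z * (u_ z + v_ z) - x_ z))) in E. lra.
    + match goal with |- context [Dtot_t ?F] =>
        replace (Dtot_t F) with (fun z =>
          a * / 3 * sum_flux a c z
          + a * t_ z * (4 * a * (u_ z + v_ z) ^ 2 * (u_t z + v_t z)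
                        + 2 * c * ((u_t z + v_t z) * (z (cu 0 2) + z (cv 0 2))
                                   + (u_ z + v_ z) * (z (cu 1 2) + z (cv 1 2))
                                   - (u_x z + v_x z) * (z (cu 1 1) + z (cv 1 1))))
          - x_ z * (2 * a * (u_ z + v_ z) * (u_t z + v_t z)
                    + c * (z (cu 1 2) + z (cv 1 2)))
          + c * (z (cu 1 1) + z (cv 1 1)))
          by (symmetry; unfold sum_flux; total_derivative)
      end.
      unfold Ibragimov_x.
      rewrite Dxx_Wu_X2, Dxx_Wv_X2, Dx_Wu_X2, Dx_Wv_X2,
        Dxx_lift_galilean, Dx_lift_galilean, d_u_f, d_v_f, d_u_g, d_v_g.
      unfold X2, Wu, Wv, lift, sum_flux; simpl. lra.
Qed.

(** * Conservation laws provided by X1, Y1 and X2 *)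

Theorem proposition3 (a b c : R) (p : nat)
  (hc : c <> 0) (hab : ~ (a = 0 /\ b = 0)) (hp : (1 <= p)%nat) :
  (* i; for p = 2 the multiplying constant (p - 2) / (2 p (p + 1)) vanishes *)
  (a = 0 -> p <> 2%nat ->
    let Ct := fun z : jet => (INR p + 1) * (u_ z ^ 2 + v_ z ^ 2) in
    let Cx := fun z : jet =>
      2 * b * (2 * INR p + 1) * (u_ z * v_ z) ^ (p + 1)
      + c * (INR p + 1) *
        (Dtot_x (Dtot_x (fun z => u_ z ^ 2 + v_ z ^ 2)) z - 3 * (u_x z ^ 2 + v_x z ^ 2)) in
    conserved_vector a b c p Ct Cx /\
    provides a b c p (X1 p) (fun t x u v => u) (fun t x u v => v) Ct Cx) /\
  (* ii *)
  (b = 0 ->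
    (* ii.a *)
    (p = 1%nat ->
      let Ct := fun z : jet => 3 * (u_ z + v_ z) ^ 2 in
      let Cx := fun z : jet =>
        4 * a * (u_ z + v_ z) ^ 3
        + 3 * c * (Dtot_x (Dtot_x (fun z => (u_ z + v_ z) ^ 2)) z
                   - 3 * (u_x z + v_x z) ^ 2) in
      conserved_vector a b c p Ct Cx /\
      provides a b c p (Y1 p)
        (fun t x u v => u + v) (fun t x u v => u + v) Ct Cx /\
      provides a b c p X2
        (fun t x u v => 2 * a * t * (u + v) - x)
        (fun t x u v => 2 * a * t * (u + v) - x) Ct Cx) /\
    (* ii.b *)
    (p = 2%nat ->
      let Ct := fun z : jet => 2 * (u_ z ^ 2 + v_ z ^ 2) in
      let Cx := fun z : jet =>
        3 * a * (u_ z ^ 2 + v_ z ^ 2) ^ 2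
        + 2 * c * (Dtot_x (Dtot_x (fun z => u_ z ^ 2 + v_ z ^ 2)) z
                   - 3 * (u_x z ^ 2 + v_x z ^ 2)) in
      conserved_vector a b c p Ct Cx /\
      provides a b c p (Y1 p)
        (fun t x u v => u) (fun t x u v => v) Ct Cx)).
Proof.
  split; [intros -> hp2 Ct Cx | intros ->; split; intros -> Ct Cx].
  - change (X1 p) with (scaling (1 / INR p)).
    destruct p as [|n]; [lia|].
    pose proof (pos_INR n) as Hn.
    replace Cx with (fun z => 2 * (INR (S n) + 1)
        * (b * (2 * INR n + 3) / (INR n + 2) * (u_ z * v_ z) ^ S (S n))
        + (INR (S n) + 1) * c * dispersion_flux z).
    2: { apply functional_extensionality; intro z. unfold Cx.
         rewrite dispersion_flux_eq, S_INR, Nat.add_1_r. field. lra. }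
    split.
    + apply (energy_conserved _ _ _ _ _ _ hp); [unfold Rdiv; jet_poly|].
      apply product_energy_flux.
    + apply (scaling_provides_energy _ _ _ _ _ _ _ hp).
      * unfold Rdiv; jet_poly.
      * apply product_energy_flux.
      * intro z. rewrite d_u_f, d_v_f, d_u_g, d_v_g, S_INR. simpl. field. lra.
      * rewrite S_INR. lra.
      * rewrite S_INR. intro H. apply hp2. f_equal. apply INR_eq.
        apply (f_equal (Rmult (2 * (INR n + 1)))) in H.
        field_simplify in H; simpl; lra.
  - assert (Ha : a <> 0) by tauto.
    replace Cx with (sum_flux a c)
      by (apply functional_extensionality; intro z; unfold Cx; now rewrite sum_flux_eq).
    change Ct with sum_density.
    replace (Y1 1) with (scaling 2)
      by (unfold Y1, scaling; simpl; now rewrite Rdiv_1_r).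
    split; [apply sum_conserved|]. split; [apply scaling_provides_sum|].
    now apply time_translation_provides_sum.
  - replace Cx with (fun z => 2 * 2 * (3 / 4 * a * (u_ z ^ 2 + v_ z ^ 2) ^ 2)
        + 2 * c * dispersion_flux z).
    2: { apply functional_extensionality; intro z. unfold Cx.
         rewrite dispersion_flux_eq. field. }
    replace (Y1 2) with (scaling 1)
      by (unfold Y1, scaling; simpl; do 2 f_equal; now replace (2 / (1 + 1)) with 1 by field).
    split.
    + apply (energy_conserved _ _ _ _ _ _ hp); [unfold Rdiv; jet_poly|].
      apply quartic_energy_flux.
    + apply (scaling_provides_energy _ _ _ _ _ _ _ hp).
      * unfold Rdiv; jet_poly.
      * apply quartic_energy_flux.
      * intro z. rewrite d_u_f, d_v_f, d_u_g, d_v_g. simpl. field.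
      * lra.
      * lra.
Qed.
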